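(* Let $r\ge 2$, $d\ge 1$ be integers, $n=(r-1)(d+1)+1$, and let $A\subset\mathbb{R}^d$ be a set of $n$ points whose $dn$ coordinates are algebraically independent. Let $M\subset A$ be any subset (of any size) with $\operatorname{conv} M\cap\operatorname{conv}(A\setminus M)=\emptyset$. Then there is a partition $\{A_1,\ldots,A_r\}$ of $A$ and a solution $(z,\alpha)$, $z\in\mathbb{R}^d$, $\alpha:A\to\mathbb{R}$, of the system \[ z=\sum_{x\in A_j}\alpha(x)\,x \quad\text{and}\quad 1=\sum_{x\in A_j}\alpha(x)\qquad\text{for all } j\in[r], \] such that either $\alpha(x)<0$ if and only if $x\in M$, or $\alpha(x)<0$ if and only if $x\notin M$.
   Context: $[r]=\{1,\ldots,r\}$; $\operatorname{conv}$ denotes convex hull, with $\operatorname{conv}\emptyset=\emptyset$. *)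

(* Defs.v *)
From Stdlib Require Import Reals QArith Qreals.
From mathcomp Require Import all_boot.

Set Implicit Arguments.
Unset Strict Implicit.
Unset Printing Implicit Defensive.

Local Open Scope R_scope.


(* A family x : I -> R (I finite) is algebraically independent over Q:
   no nonzero polynomial with rational coefficients in the variables X_i
   vanishes at x.  A polynomial is given by a duplicate-free list s of
   exponent vectors (monomials) and a coefficient for each; it is nonzero
   iff some listed monomial has nonzero coefficient. *)
Definition alg_indep (I : finType) (x : I -> R) : Prop :=
  forall (s : seq {ffun I -> nat}) (c : {ffun I -> nat} -> Q),
    uniq s ->
    (exists2 m, m \in s & ~ Qeq (c m) 0%Q) ->
    \big[Rplus/R0]_(m <- s) (Q2R (c m) * \big[Rmult/R1]_(i : I) (x i ^ m i))
      <> 0.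

(* A point in R^d is a function 'I_d -> R.  z lies in the convex hull of the
   points a i, i in S (conv of the empty set is empty, automatically). *)
Definition in_conv (n d : nat) (a : 'I_n -> 'I_d -> R) (S : {set 'I_n})
  (z : 'I_d -> R) : Prop :=
  exists lam : 'I_n -> R,
    (forall i, 0 <= lam i) /\
    (forall i, i \notin S -> lam i = 0) /\
    \big[Rplus/R0]_(i : 'I_n) lam i = 1 /\
    (forall k : 'I_d, z k = \big[Rplus/R0]_(i : 'I_n) (lam i * a i k)).

(* Main.v *)
Require Import Defs.
From Stdlib Require Import Reals QArith Qreals Classical.
From mathcomp Require Import all_boot all_order all_algebra.
From mathcomp Require Import Rstruct ring lra zify mpoly.

(* Replace each point x by the vector (x, 1), with its sign changed when x lies
   in M. Sarkaria's tensor trick and the colourful Caratheodory theorem, applied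
   to these vectors, give a partition and nonnegative coefficients b, not all
   zero, whose block sums are all equal to one vector w. If w vanished, the
   total sum would be a nontrivial relation saying that conv M meets
   conv (A \ M). Algebraic independence then forces every coefficient and the
   last coordinate t of w to be nonzero. Dividing the signed coefficients by t
   gives alpha, and the sign of t decides which alternative holds. *)

Set Implicit Arguments.
Unset Strict Implicit.
Unset Printing Implicit Defensive.
Import Order.TTheory GRing.Theory Num.Theory.
Local Open Scope ring_scope.

(** * Minimal-norm points and the colourful Caratheodory theorem *)

Definition dot (F : realFieldType) m (u v : 'rV[F]_m) : F := (u *m v^T) 0 0.

Lemma dotE (F : realFieldType) m (u v : 'rV[F]_m) :
  dot u v = \sum_k u 0 k * v 0 k.
Proof. by rewrite /dot mxE; apply: eq_bigr => k _; rewrite mxE. Qed.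

Lemma dotC (F : realFieldType) m (u v : 'rV[F]_m) : dot u v = dot v u.
Proof. by rewrite !dotE; apply: eq_bigr => k _; rewrite mulrC. Qed.

Lemma dotDl (F : realFieldType) m (u u' v : 'rV[F]_m) :
  dot (u + u') v = dot u v + dot u' v.
Proof. by rewrite /dot mulmxDl mxE. Qed.

Lemma dotDr (F : realFieldType) m (u v v' : 'rV[F]_m) :
  dot u (v + v') = dot u v + dot u v'.
Proof. by rewrite dotC dotDl !(dotC _ u). Qed.

Lemma dotZl (F : realFieldType) m a (u v : 'rV[F]_m) :
  dot (a *: u) v = a * dot u v.
Proof. by rewrite /dot -scalemxAl mxE. Qed.

Lemma dotZr (F : realFieldType) m a (u v : 'rV[F]_m) :
  dot u (a *: v) = a * dot u v.
Proof. by rewrite dotC dotZl dotC. Qed.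

Lemma dotBl (F : realFieldType) m (u u' v : 'rV[F]_m) :
  dot (u - u') v = dot u v - dot u' v.
Proof. by rewrite -scaleN1r dotDl dotZl mulN1r. Qed.

Lemma dot_suml (F : realFieldType) m (I : finType) (l : I -> F)
    (c : I -> 'rV[F]_m) v :
  dot (\sum_i l i *: c i) v = \sum_i l i * dot (c i) v.
Proof.
rewrite /dot mulmx_suml summxE; apply: eq_bigr => i _.
by rewrite -scalemxAl mxE.
Qed.

Lemma dot_ge0 (F : realFieldType) m (u : 'rV[F]_m) : 0 <= dot u u.
Proof. by rewrite dotE sumr_ge0 // => k _; rewrite -expr2 sqr_ge0. Qed.

Lemma dot_eq0 (F : realFieldType) m (u : 'rV[F]_m) : (dot u u == 0) = (u == 0).
Proof.
apply/idP/eqP => [|->]; last by rewrite /dot mul0mx mxE.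
rewrite dotE psumr_eq0 => [/allP u0|k _]; last by rewrite -expr2 sqr_ge0.
apply/rowP => k; rewrite mxE; apply/eqP.
by have := u0 k (mem_index_enum k); rewrite mulf_eq0 orbb.
Qed.

Lemma mulmx_gram_eq0 (F : realFieldType) m n (D : 'M[F]_(m, n)) (v : 'rV_m) :
  v *m (D *m D^T) = 0 -> v *m D = 0.
Proof.
move=> vD; apply/eqP; rewrite -dot_eq0 /dot trmx_mul -mulmxA (mulmxA D).
by rewrite mulmxA vD mul0mx mxE.
Qed.

(** Over an ordered field [D *m D^T] has the rank of [D], because [v *m D *m D^T *m v^T] is the
    squared norm of [v *m D]. Its row space is therefore that of [D^T], which contains
    [- (x *m D^T)]. *)
Lemma normal_equations (F : realFieldType) m n (D : 'M[F]_(m, n)) (x : 'rV_n) :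
  exists u : 'rV_m, (x + u *m D) *m D^T = 0.
Proof.
have rkD : (\rank D <= \rank (D *m D^T))%N.
  have: (kermx (D *m D^T) <= kermx D)%MS.
    apply/rV_subP => v /sub_kermxP vD; apply/sub_kermxP.
    exact: mulmx_gram_eq0.
  move/mxrankS; rewrite !mxrank_ker => le.
  have := rank_leq_row D; have := rank_leq_row (D *m D^T); lia.
have : (- (x *m D^T) <= D *m D^T)%MS.
  have /andP[_ sub] : (D *m D^T == D^T)%MS.
    by rewrite -(geq_leqif (mxrank_leqif_eq (submxMl _ _))) mxrank_tr.
  by rewrite eqmx_opp; apply: submx_trans sub; apply: submxMl.
case/submxP => u xu; exists u.
by rewrite mulmxDl -mulmxA -xu subrr.
Qed.

(** The ratio test: [t] is the least value of [l i / - g i] over those [i] in [S] with [g i]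
    negative. *)
Lemma first_zero_along (F : realFieldType) (I : finType) (S : {set I})
    (l g : I -> F) :
  {in S, forall i, 0 < l i} -> (exists2 i, i \in S & g i < 0) ->
  exists t, [/\ 0 < t, {in S, forall i, 0 <= l i + t * g i}
    & exists2 i, i \in S & l i + t * g i = 0].
Proof.
move=> l_gt0 [i0 Si0 g0].
have Pi0 : (i0 \in S) && (g i0 < 0) by rewrite Si0.
case: (@arg_minP _ _ _ i0 (fun i => (i \in S) && (g i < 0))
  (fun i => l i / - g i) Pi0) => i /andP[Si gi] imin.
exists (l i / - g i); split.
- by rewrite divr_gt0 ?l_gt0 ?oppr_gt0.
- move=> k Sk; case: (ltP (g k) 0) => gk; last first.
    by rewrite addr_ge0 ?mulr_ge0 ?invr_ge0 ?oppr_ge0 // ltW // l_gt0.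
  have := imin k; rewrite Sk gk => /(_ isT).
  have gk' : 0 < - g k by rewrite oppr_gt0.
  by rewrite (ler_pdivlMr _ _ gk') mulrN -subr_ge0 opprK.
- by exists i => //; field; rewrite lt_eqF.
Qed.

Lemma sum_deltaZ (F : nzRingType) (V : lmodType F) (I : finType) (i0 : I)
    (x : I -> V) :
  \sum_i (i == i0)%:R *: x i = x i0.
Proof.
rewrite (bigD1 i0) //= eqxx scale1r big1 ?addr0 // => i /negbTE ->.
by rewrite scale0r.
Qed.

Lemma sum_delta (F : nzRingType) (I : finType) (i0 : I) :
  \sum_i (i == i0)%:R = 1 :> F.
Proof. by rewrite (bigD1 i0) //= eqxx big1 ?addr0 // => i /negbTE ->. Qed.

Definition convex_weights (F : realFieldType) (I : finType) (l : I -> F) :=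
  (forall i, 0 <= l i) /\ \sum_i l i = 1.

Lemma linear_dependence (F : fieldType) (I : finType) m (S : {set I})
    (c : I -> 'rV[F]_m) :
  (m < #|S|)%N ->
  exists g : I -> F, [/\ forall i, i \notin S -> g i = 0,
    exists2 i, i \in S & g i != 0 & \sum_i g i *: c i = 0].
Proof.
move=> mS; pose B : 'M[F]_(#|S|, m) := \matrix_k c (enum_val k).
have : kermx B != 0.
  rewrite kermx_eq0 /row_free neq_ltn.
  by rewrite (leq_ltn_trans (rank_leq_col B)).
case/rowV0Pn => v /sub_kermxP vB v0.
have [k vk] : exists k, v 0 k != 0.
  apply/existsP; apply: contraR v0 => /existsPn v0.
  by apply/eqP/rowP => k; rewrite mxE; apply/eqP; rewrite -[_ == _]negbK v0.
have k0S : enum_val k \in S := enum_valP k.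
pose g i := if i \in S then v 0 (enum_rank_in k0S i) else 0.
have gE j : g (enum_val j) = v 0 j.
  by rewrite /g enum_valP enum_valK_in.
exists g; split=> [i|| ]; first by rewrite /g => /negbTE ->.
  by exists (enum_val k); rewrite ?gE.
rewrite (bigID (mem S)) /= [X in _ + X]big1 ?addr0; last first.
  by move=> i /negbTE iS; rewrite /g iS scale0r.
rewrite (reindex_omap enum_val (fun i => Some (enum_rank_in k0S i))) /=; last first.
  by move=> i iS; rewrite enum_rankK_in.
rewrite -[RHS]vB mulmx_sum_row; apply: eq_big => [j|j _].
  by rewrite enum_valP enum_valK_in eqxx.
by rewrite gE rowK.
Qed.

(** The last condition makes [p] the projection of the origin onto the affine hull of the [c i] with
    [i] in [S]; the weights put it in their convex hull. As there are finitely many [S], norms can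
    be minimised over such points without compactness. *)
Definition stationary (F : realFieldType) (I : finType) m (c : I -> 'rV[F]_m)
    (S : {set I}) (p : 'rV[F]_m) :=
  exists l, [/\ convex_weights l, forall i, i \notin S -> l i = 0,
    p = \sum_i l i *: c i & {in S, forall i, dot (c i) p = dot p p}].

Lemma convex_weights_segment (F : realFieldType) (I : finType) (l l' : I -> F) t :
  convex_weights l -> convex_weights l' -> 0 <= t <= 1 ->
  convex_weights (fun i => l i + t * (l' i - l i)).
Proof.
move=> [l0 l1] [l'0 l'1] /andP[t0 t1]; split=> [i|].
  have -> : l i + t * (l' i - l i) = (1 - t) * l i + t * l' i by ring.
  by rewrite addr_ge0 // mulr_ge0 // subr_ge0.
by rewrite big_split -mulr_sumr /= sumrB l1 l'1 subrr mulr0 addr0.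
Qed.

Lemma affine_projection (F : realFieldType) (I : finType) m
    (c : I -> 'rV[F]_m) (S : {set I}) (l : I -> F) (i0 : I) :
  i0 \in S -> (forall i, i \notin S -> l i = 0) -> \sum_i l i = 1 ->
  exists l' : I -> F, [/\ forall i, i \notin S -> l' i = 0, \sum_i l' i = 1
    & let q := \sum_i l' i *: c i in
      {in S, forall i, dot (c i) q = dot q q}].
Proof.
move=> Si0 lS l1.
pose D : 'M[F]_(#|I|, m) :=
  \matrix_k ((enum_val k \in S)%:R *: (c (enum_val k) - c i0)).
have [u uD] := normal_equations D (\sum_i l i *: c i).
pose w i := (i \in S)%:R * u 0 (enum_rank i).
(* The normal equations give the shift along the differences [c k - c i0]; subtracting its total at
   [i0] keeps the weights summing to one. *)
pose l' i := l i + w i - (i == i0)%:R * \sum_k w k.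
have l'1 : \sum_i l' i = 1.
  by rewrite sumrB big_split /= l1 -mulr_suml sum_delta mul1r addrK.
have qE : \sum_i l' i *: c i = \sum_i l i *: c i + u *m D.
  have -> : u *m D = \sum_i w i *: (c i - c i0).
    rewrite mulmx_sum_row (reindex enum_rank) /=; last first.
      by exists enum_val => i _; rewrite ?enum_rankK ?enum_valK.
    apply: eq_bigr => i _; rewrite rowK enum_rankK scalerA.
    by congr (_ *: _); rewrite mulrC.
  under eq_bigr do rewrite scalerBl scalerDl.
  under [\sum_i w i *: _]eq_bigr do rewrite scalerBr.
  rewrite sumrB big_split /= sumrB -addrA; congr (_ + (_ - _)).
  by under eq_bigr do rewrite -scalerA; rewrite sum_deltaZ scaler_suml.
exists l'; split=> // [i iS|q i iS].
  rewrite /l' /w lS // (negbTE iS) mul0r !add0r.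
  by case: eqP iS => [->|_ _]; rewrite ?Si0 // mul0r oppr0.
have perp k : k \in S -> dot (c k) q = dot (c i0) q.
  move=> kS; apply/eqP; rewrite -subr_eq0 -dotBl dotC /q qE.
  have := congr1 (fun M : 'rV_#|I| => M 0 (enum_rank k)) uD.
  rewrite mxE [RHS]mxE => <-; apply/eqP; rewrite dotE; apply: eq_bigr => j _.
  by rewrite !mxE enum_rankK kS mul1r.
rewrite perp // {2}/q dot_suml.
have -> : \sum_k l' k * dot (c k) q = \sum_k l' k * dot (c i0) q.
  apply: eq_bigr => k _; have [kS|kS] := boolP (k \in S); first by rewrite perp.
  have -> : l' k = 0.
    rewrite /l' /w lS // (negbTE kS) mul0r !add0r.
    by case: eqP kS => [->|_ _]; rewrite ?Si0 // mul0r oppr0.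
  by rewrite !mul0r.
by rewrite -mulr_suml l'1 mul1r.
Qed.

(* Walk from x towards the projection q of the origin on the affine hull of
   the support of x: the norm decreases, and either q is reached or a weight
   vanishes on the way. *)
Lemma stationary_below (F : realFieldType) (I : finType) m
    (c : I -> 'rV[F]_m) (l : I -> F) :
  convex_weights l ->
  exists S p, stationary c S p /\
    dot p p <= dot (\sum_i l i *: c i) (\sum_i l i *: c i).
Proof.
have [k] := ubnP #|[set i | l i != 0]|.
elim: k l => // k IH l; rewrite ltnS; set S := [set i | _] => Sk cl.
have [l0 l1] := cl.
have lS i : i \notin S -> l i = 0 by rewrite inE negbK => /eqP.
have lgt0 : {in S, forall i, 0 < l i} by move=> i; rewrite inE lt_def l0 andbT.
have [i0 Si0] : exists i, i \in S.
  apply/existsP; apply: contraT => /existsPn S0; move: l1.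
  rewrite big1 => [/esym/eqP|i _]; last exact: lS.
  by rewrite oner_eq0.
have [l' [l'S l'1 st]] := affine_projection c Si0 lS l1.
set q := (\sum_i l' i *: c i) in st; set x := \sum_i l i *: c i.
have xE t : \sum_i (l i + t * (l' i - l i)) *: c i = q + (1 - t) *: (x - q).
  under eq_bigr => i _.
    rewrite (_ : _ + _ = (1 - t) * l i + t * l' i); last by ring.
    by rewrite scalerDl -!scalerA over.
  have combo (y z : 'rV[F]_m) : (1 - t) *: y + t *: z = z + (1 - t) *: (y - z).
    by apply/rowP => j; rewrite !mxE; ring.
  by rewrite big_split /= -!scaler_sumr combo.
have orth : dot (x - q) q = 0.
  rewrite dotBl {1}/x dot_suml.
  have -> : \sum_i l i * dot (c i) q = \sum_i l i * dot q q.
    apply: eq_bigr => i _; have [iS|iS] := boolP (i \in S); first by rewrite st.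
    by rewrite lS // !mul0r.
  by rewrite -mulr_suml l1 mul1r subrr.
have normE t : dot (q + (1 - t) *: (x - q)) (q + (1 - t) *: (x - q)) =
    dot q q + (1 - t) ^+ 2 * dot (x - q) (x - q).
  move: (x - q) orth => w orth.
  by rewrite !dotDl !dotDr !(dotZl, dotZr) (dotC q w) orth; ring.
have xx : dot x x = dot q q + dot (x - q) (x - q).
  have := normE 0; rewrite subr0 scale1r expr1n mul1r => <-.
  by rewrite addrC subrK.
have [l'0|] := boolP [forall i, 0 <= l' i].
  exists S, q; split; last by rewrite xx lerDl dot_ge0.
  by exists l'; split=> //; split=> // i; apply: (forallP l'0).
rewrite negb_forall => /existsP[i1]; rewrite -ltNge => l'i1.
have Si1 : i1 \in S.
  by apply: contraLR l'i1 => /l'S ->; rewrite ltxx.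
have neg : exists2 i, i \in S & l' i - l i < 0.
  by exists i1 => //; rewrite subr_lt0 (lt_le_trans l'i1).
have [t [t0 tge0 [i2 Si2 ti2]]] := first_zero_along lgt0 neg.
(* At time 1 the weight of [i1] is [l' i1 < 0], but at time [t] it is still nonnegative. *)
have t1 : t <= 1.
  have := tge0 _ Si1; have := lgt0 _ Si1; move: l'i1; nra.
set l2 := fun i => l i + t * (l' i - l i).
have l2S i : i \notin S -> l2 i = 0.
  by move=> iS; rewrite /l2 lS // l'S // subrr mulr0 addr0.
have cl2 : convex_weights l2.
  split=> [i|]; last by rewrite big_split -mulr_sumr /= sumrB l1 l'1 subrr mulr0 addr0.
  by have [iS|iS] := boolP (i \in S); [apply: tge0 | rewrite l2S].
have [|S' [p [stp le]]] := IH l2 _ cl2.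
  apply: leq_trans Sk; apply: proper_card; apply/properP; split.
    apply/subsetP => i; rewrite inE; apply: contraNT => iS; by rewrite l2S.
  by exists i2; rewrite // inE negbK; apply/eqP.
exists S', p; split=> //; apply: (le_trans le); rewrite xE normE xx lerD2l.
by rewrite ler_piMl ?dot_ge0 // exprn_ile1 ?subr_ge0 // gerBl ltW.
Qed.

(** Averaging the equations of [p'] with the weights of [p] gives [dot p p' = dot p' p']; exchanging
    the roles gives [dot p' p = dot p p]. *)
Lemma stationary_norm_uniq (F : realFieldType) (I : finType) m
    (c : I -> 'rV[F]_m) (S : {set I}) (p p' : 'rV[F]_m) :
  stationary c S p -> stationary c S p' -> dot p p = dot p' p'.
Proof.
have half q q' : stationary c S q -> stationary c S q' -> dot q q' = dot q' q'.
  move=> [l [[_ l1] lS -> _]] [l' [_ _ _ st]]; rewrite dot_suml.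
  have -> : \sum_i l i * dot (c i) q' = \sum_i l i * dot q' q'.
    apply: eq_bigr => i _; have [iS|iS] := boolP (i \in S); first by rewrite st.
    by rewrite lS // !mul0r.
  by rewrite -mulr_suml l1 mul1r.
by move=> sp sp'; rewrite -(half p p') // -(half p' p) // dotC.
Qed.

(** [P] is the graph of a partial function on a finite type; classical logic decides where it is
    defined. *)
Lemma finite_min (F : realFieldType) (K : finType) (P : K -> F -> Prop) :
  (forall k v v', P k v -> P k v' -> v = v') -> (exists k v, P k v) ->
  exists k v, P k v /\ forall k' v', P k' v' -> v <= v'.
Proof.
move=> Pfun [k0 [v0 Pk0]].
suff mins (s : seq K) : (forall k, k \in s -> forall v, ~ P k v) \/
    exists k v, P k v /\ forall k' v', k' \in s -> P k' v' -> v <= v'.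
  have [none|[k [v [Pk vmin]]]] := mins (enum K).
    by case: (none k0 (mem_enum _ _) v0).
  by exists k, v; split=> // k' v'; apply: vmin; rewrite mem_enum.
elim: s => [|k s [none|[k1 [v1 [Pk1 v1min]]]]]; first by left.
  have [[v Pk]|nPk] := classic (exists v, P k v).
    right; exists k, v; split=> // k' v'; rewrite inE => /orP[/eqP ->|k's] Pk'.
      by rewrite (Pfun _ _ _ Pk Pk').
    by case: (none k' k's v').
  left=> k'; rewrite inE => /orP[/eqP -> v Pk|]; last exact: none.
  by case: nPk; exists v.
right; have [[v Pk]|nPk] := classic (exists v, P k v).
  have [vv1|v1v] := leP v v1.
    exists k, v; split=> // k' v'; rewrite inE => /orP[/eqP -> Pk'|k's Pk'].
      by rewrite (Pfun _ _ _ Pk Pk').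
    exact: le_trans vv1 (v1min _ _ k's Pk').
  exists k1, v1; split=> // k' v'; rewrite inE => /orP[/eqP -> Pk'|].
    by rewrite (Pfun _ _ _ Pk' Pk) ltW.
  exact: v1min.
exists k1, v1; split=> // k' v'; rewrite inE => /orP[/eqP -> Pk'|].
  by case: nPk; exists v'.
exact: v1min.
Qed.

Lemma le_norm_segment (F : realFieldType) m (p c : 'rV[F]_m) :
  (forall t, 0 <= t <= 1 ->
     dot p p <= dot (p + t *: (c - p)) (p + t *: (c - p))) ->
  dot p p <= dot c p.
Proof.
move: (subrK p c) => /esym ->; move: (c - p) => w; rewrite addrK => hmin.
rewrite dotDl lerDr leNgt; apply/negP; set s := dot w p; set D := dot w w => s0.
have D0 : 0 <= D := dot_ge0 _.
have Ds : 0 < D - s by lra.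
have Ds0 : D - s != 0 by rewrite gt_eqF.
(* The squared norm changes by [2 * t * s + t ^+ 2 * D]; this choice turns the change into
   [t * s + t ^+ 2 * s], which is negative. *)
pose t := - s / (D - s).
have tE : t * (D - s) = - s by rewrite /t divfK.
have t0 : 0 < t by rewrite divr_gt0 // oppr_gt0.
have t1 : t <= 1 by rewrite ler_pdivrMr //; lra.
have := hmin t; rewrite (ltW t0) t1 => /(_ isT).
rewrite !dotDl !dotDr !(dotZl, dotZr) (dotC p w) -/s -/D.
have := mulr_gt0 t0 (_ : 0 < - s); nra.
Qed.

(* Barany's argument: at a point p of minimal norm over all selections some
   colour i0 carries weight zero, so its point may be exchanged for one in the
   half-space <., p> <= 0, which by minimality forces p = 0. *)
Lemma colourful_caratheodory (F : realFieldType) (I J : finType) m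
    (c : I -> J -> 'rV[F]_m) :
  (m < #|I|)%N ->
  (forall i, exists mu, convex_weights mu /\ \sum_j mu j *: c i j = 0) ->
  exists (f : I -> J) (l : I -> F),
    convex_weights l /\ \sum_i l i *: c i (f i) = 0.
Proof.
move=> mI c0.
pose cf (f : {ffun I -> J}) i := c i (f i).
pose P (k : {ffun I -> J} * {set I}) v :=
  exists2 p, stationary (cf k.1) k.2 p & v = dot p p.
have Pfun k v v' : P k v -> P k v' -> v = v'.
  by move=> [p sp ->] [p' sp' ->]; apply: stationary_norm_uniq sp sp'.
have /card_gt0P[i1 _] : (0 < #|I|)%N := leq_ltn_trans (leq0n m) mI.
have [j1 _] : exists j : J, j \in J.
  have [mu [[_ mu1] _]] := c0 i1; apply/existsP; apply: contraT => /existsPn J0.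
  move: mu1; rewrite big1 => [/esym/eqP|j _]; first by rewrite oner_eq0.
  by have := J0 j; rewrite inE.
have below f l : convex_weights l -> exists k v, P k v /\
    v <= dot (\sum_i l i *: cf f i) (\sum_i l i *: cf f i).
  case/(stationary_below (cf f)) => S [p [sp le]].
  by exists (f, S), (dot p p); split=> //; exists p.
have [|[f S] [v [[p [l [cl lS pE st]] ->] vmin]]] := finite_min Pfun.
  have [|k [v [Pk _]]] := below [ffun=> j1] (fun i => (i == i1)%:R); last first.
    by exists k, v.
  by split=> [i|]; [apply: ler0n | apply: sum_delta].
rewrite /= in lS pE st.
have pmin f' l' : convex_weights l' ->
    dot p p <= dot (\sum_i l' i *: cf f' i) (\sum_i l' i *: cf f' i).
  by case/(below f') => k [w [/vmin le /(le_trans le)]].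
have variational f' l' i : convex_weights l' -> p = \sum_i l' i *: cf f' i ->
    dot p p <= dot (cf f' i) p.
  move=> cl' pE'; apply: le_norm_segment => t t01.
  have cd : convex_weights (fun k : I => (k == i)%:R : F).
    by split=> [k|]; [apply: ler0n | apply: sum_delta].
  have := pmin f' _ (convex_weights_segment cl' cd t01).
  congr (_ <= dot _ _);
    under eq_bigr do rewrite scalerDl -scalerA scalerBl;
    by rewrite big_split -scaler_sumr sumrB -pE' sum_deltaZ.
have [p0|pn0] := eqVneq (dot p p) 0.
  by exists f, l; split=> //; rewrite -[LHS]pE; apply/eqP; rewrite -dot_eq0 p0.
(* If all weights are positive, every chosen point lies on the hyperplane [dot _ p = dot p p]. More
   than [m] vectors are dependent, and moving the weights along a dependence fixes [p] until one of
   them vanishes. *)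
have [i0 [l' [cl' pE' l'0]]] : exists i0 l',
    [/\ convex_weights l', p = \sum_i l' i *: cf f i & l' i0 = 0].
  have [|] := boolP [exists i, l i == 0].
    by case/existsP => i /eqP li; exists i, l.
  rewrite negb_exists => /forallP l_neq0.
  have p_eq i : dot (cf f i) p = dot p p.
    by apply: st; apply: contraR (l_neq0 i) => /lS ->.
  have mT : (m < #|[set: I]|)%N by rewrite cardsT.
  have [g [_ [i2 _ gi2] g0]] := linear_dependence (cf f) mT.
  (* Pairing the dependence with [p] gives [(\sum_i g i) * dot p p = 0]. *)
  have gsum : \sum_i g i = 0.
    apply/eqP; rewrite -(mulIr_eq0 _ (mulIf pn0)) mulr_suml.
    by under eq_bigr => i _ do rewrite -(p_eq i); rewrite -dot_suml g0 /dot mul0mx mxE.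
  have l_gt0 : {in [set: I], forall i, 0 < l i}.
    by move=> i _; rewrite lt_def l_neq0 cl.1.
  have neg : exists2 i, i \in [set: I] & g i < 0.
    have [|gge0] := boolP [exists i, g i < 0].
      by case/existsP => i gi; exists i.
    have gge0' i : 0 <= g i by move: gge0; rewrite negb_exists => /forallP/(_ i); rewrite -leNgt.
    move/eqP: gsum; rewrite psumr_eq0 // => /allP/(_ i2 (mem_index_enum _)).
    by rewrite (negbTE gi2).
  have [t [_ tge0 [i3 _ ti3]]] := first_zero_along l_gt0 neg.
  exists i3, (fun i => l i + t * g i); split=> //.
    split=> [i|]; first by apply: tge0.
    by rewrite big_split -mulr_sumr /= gsum mulr0 addr0 cl.2.
  under eq_bigr do rewrite scalerDl -scalerA.
  by rewrite big_split -scaler_sumr /= g0 scaler0 addr0.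
have [mu [[mu0 mu1] muc]] := c0 i0.
(* The origin is a convex combination of colour [i0], so not all of that colour can lie strictly on
   the positive side of [p]. *)
have [j cj] : exists j, dot (c i0 j) p <= 0.
  apply/existsP; apply: contraT; rewrite negb_exists => /forallP cpos.
  have : \sum_j mu j * dot (c i0 j) p == 0 by rewrite -dot_suml muc /dot mul0mx mxE.
  rewrite psumr_eq0 => [/allP mu00|j _]; last first.
    by rewrite mulr_ge0 // ltW // ltNge.
  move: mu1; rewrite big1 => [/esym/eqP|j _]; first by rewrite oner_eq0.
  have := mu00 j (mem_index_enum _); rewrite mulf_eq0 => /orP[/eqP //|/eqP z].
  by have := cpos j; rewrite z lexx.
pose f' := [ffun i => if i == i0 then j else f i].
have pf' : p = \sum_i l' i *: cf f' i.
  rewrite pE'; apply: eq_bigr => i _; rewrite /cf ffunE.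
  by case: eqP => // ->; rewrite l'0 !scale0r.
have := variational f' l' i0 cl' pf'; rewrite /cf ffunE eqxx => le.
exists f', l'; split=> //; rewrite -[LHS]pf'; apply/eqP; rewrite -dot_eq0.
by rewrite eq_le dot_ge0 (le_trans le).
Qed.

(** * Algebraically independent points *)

(* g i is the rank modulo d + 1 of i in S, enumerated block after block. *)
Lemma cyclic_labelling (I : finType) r d (f : I -> 'I_r) (S : {set I}) :
  (forall j, #|[set i in S | f i == j]| <= d.+1)%N ->
  exists g : I -> 'I_d.+1,
    {in S &, forall i i', f i = f i' -> g i = g i' -> i = i'} /\
    forall (k : 'I_d.+1) q, (#|S| <= q * d.+1 + k)%N ->
      (#|[set i in S | g i == k]| <= q)%N.
Proof.
(* [key] orders the indices lexicographically, first by block and then by rank in [I]. *)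
move=> hS; pose key i := (f i * #|I| + enum_rank i)%N.
have key_div i : (key i %/ #|I|)%N = f i.
  have I0 : (0 < #|I|)%N by apply/card_gt0P; exists i.
  by rewrite /key divnMDl // divn_small ?addn0.
have key_inj : injective key.
  move=> i i' e; apply: enum_rank_inj; apply: val_inj => /=.
  by have := congr1 (modn^~ #|I|) e; rewrite /key !modnMDl !modn_small.
pose rho i := #|[set k in S | (key k < key i)%N]|.
have rho_lt i i' : i \in S -> (key i < key i')%N -> (rho i < rho i')%N.
  move=> iS lt; apply: proper_card; apply/properP; split.
    apply/subsetP => k; rewrite !inE => /andP[->] /=; lia.
  by exists i; rewrite !inE iS ?ltnn.
(* Only members of the same block lie between [i] and [i'], so their ranks differ by less than
   [d.+1] and cannot be congruent. *)
have rho_near i i' : i' \in S -> f i = f i' -> (key i < key i')%N ->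
    (rho i' < rho i + d.+1)%N.
  move=> i'S fii' lt.
  have sub : [set k in S | (key k < key i')%N] \subset
      [set k in S | (key k < key i)%N] :|: ([set k in S | f k == f i'] :\ i').
    apply/subsetP => k; rewrite !inE => /andP[-> lt'] /=.
    have [//|le] := ltnP; apply/andP; split; first by apply: contraTneq lt' => ->; rewrite ltnn.
    apply/eqP/val_inj/eqP; rewrite /= eqn_leq; apply/andP; split.
      by rewrite -key_div -(key_div i') leq_div2r // ltnW.
    by rewrite -fii' -key_div -(key_div k) leq_div2r.
  apply: leq_ltn_trans (subset_leq_card sub) _.
  apply: leq_ltn_trans (leq_card_setU _ _).1 _; rewrite ltn_add2l.
  by apply: leq_trans (hS (f i')); rewrite [in leqRHS](cardsD1 i') inE i'S eqxx.
have rho_bound i : i \in S -> (rho i < #|S|)%N.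
  move=> iS; apply: proper_card; apply/properP; split.
    by apply/subsetP => k; rewrite inE => /andP[].
  by exists i; rewrite // inE ltnn andbF.
have rho_inj : {in S &, injective rho}.
  move=> i i' iS i'S e; apply: key_inj.
  case: (ltngtP (key i) (key i')) => // lt.
    by have := rho_lt _ _ iS lt; rewrite e ltnn.
  by have := rho_lt _ _ i'S lt; rewrite e ltnn.
pose g i : 'I_d.+1 := inord (rho i %% d.+1).
have gE i : g i = (rho i %% d.+1)%N :> nat by rewrite inordK ?ltn_mod.
exists g; split.
  have aux i i' : i \in S -> i' \in S -> f i = f i' -> g i = g i' ->
      ~ (key i < key i')%N.
    move=> iS i'S fii' gii' lt.
    have e : (rho i %% d.+1 = rho i' %% d.+1)%N by rewrite -!gE gii'.
    have r1 := rho_lt _ _ iS lt; have := rho_near _ _ i'S fii' lt.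
    have : (d.+1 <= rho i' - rho i)%N.
      rewrite dvdn_leq ?subn_gt0 // -eqn_mod_dvd ?e ?eqxx //; exact: ltnW.
    by move: r1; clear; lia.
  move=> i i' iS i'S fii' gii'; apply: key_inj.
  case: (ltngtP (key i) (key i')) => // lt; first by case: (aux i i').
  by case: (aux i' i).
move=> k q le.
have inj : {in [set i in S | g i == k] &, injective (fun i => rho i %/ d.+1)%N}.
  move=> i i'; rewrite !inE => /andP[iS /eqP gi] /andP[i'S /eqP gi'] e.
  apply: rho_inj => //; rewrite (divn_eq (rho i) d.+1) (divn_eq (rho i') d.+1) e.
  by rewrite -!gE gi gi'.
(* The rank is [d.+1] times its quotient plus [k], and it is below [#|S| <= q * d.+1 + k]. *)
have q_gt i : i \in [set i in S | g i == k] -> (rho i %/ d.+1 < q)%N.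
  rewrite inE => /andP[iS /eqP gi]; have lt := leq_trans (rho_bound i iS) le.
  by rewrite (divn_eq (rho i) d.+1) -gE gi ltn_add2r ltn_mul2r in lt.
have [->|[i0 i0P]] := set_0Vmem [set i in S | g i == k]; first by rewrite cards0.
case: q le q_gt => [|q] le q_gt; first by have := q_gt _ i0P; rewrite ltn0.
rewrite -[q.+1]card_ord -(card_in_imset (f := fun i => inord (rho i %/ d.+1) : 'I_q.+1)).
  exact: max_card.
move=> i i' iP i'P /(congr1 val) /=; rewrite !inordK ?q_gt //; exact: inj.
Qed.

(* Sarkaria's trick: c i j is the tensor of v i with the j-th of r + 1 vectors
   in F^r whose only linear relation is that their sum vanishes. *)
Lemma conic_tverberg (F : realFieldType) (I K : finType) r (v : I -> K -> F) :
  (r * #|K| < #|I|)%N ->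
  exists (f : I -> 'I_r.+1) (b : I -> F) (w : K -> F), convex_weights b /\
    forall j k, \sum_(i | f i == j) b i * v i k = w k.
Proof.
move=> rKI; pose T := ('I_r * K)%type.
(* The [r.+1] vectors are the unit vectors for nonzero [j] and minus their sum for [ord0]; uniform
   weights make each colour balance at the origin. *)
pose c i (j : 'I_r.+1) : 'rV[F]_#|{: T}| := \row_t (v i (enum_val t).2 *
  ((j == lift ord0 (enum_val t).1)%:R - (j == ord0)%:R)).
have cardT : (#|{: T}| < #|I|)%N by rewrite card_prod card_ord.
have [i|f [b [cb bc]]] := colourful_caratheodory (c := c) cardT.
  exists (fun=> r.+1%:R^-1); split.
    split=> [_|]; first by rewrite invr_ge0 ler0n.
    by rewrite sumr_const card_ord -[_ *+ _]mulr_natl divff ?pnatr_eq0.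
  rewrite -scaler_sumr; apply/rowP => t; rewrite !mxE summxE.
  under eq_bigr do rewrite mxE.
  by rewrite -mulr_sumr sumrB !sum_delta subrr !mulr0.
(* Coordinate [(j', k)] of the vanishing sum is the block sum at [lift ord0 j'] minus the one at
   [ord0]. *)
exists f, b, (fun k => \sum_(i | f i == ord0) b i * v i k); split=> // j k.
have [j' ->|->//] := unliftP ord0 j.
apply/eqP; rewrite -subr_eq0; apply/eqP.
have := congr1 (fun u : 'rV_#|{: T}| => u 0 (enum_rank (j', k))) bc.
rewrite summxE [RHS]mxE => c0; rewrite -[RHS]c0 big_mkcond.
rewrite [X in _ - X]big_mkcond -sumrB; apply: eq_bigr => i _.
rewrite !mxE enum_rankK /=.
by case: (f i == _); case: (f i == _); rewrite /=; ring.
Qed.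

(** A block with more than [#|K|] indices in the support carries a linear dependence of its vectors.
    Subtracting a multiple of it kills one coefficient and leaves all block sums unchanged. *)
Lemma reduce_support (F : fieldType) (I K : finType) r (f : I -> 'I_r)
    (h : I -> K -> F) (S : {set I}) (al : I -> F) :
  (forall i, i \notin S -> al i = 0) ->
  exists (S' : {set I}) (al' : I -> F), [/\ S' \subset S,
    forall i, i \notin S' -> al' i = 0,
    forall j, (#|[set i in S' | f i == j]| <= #|K|)%N
    & forall j k, \sum_(i | f i == j) al' i * h i k =
                  \sum_(i | f i == j) al i * h i k].
Proof.
have [n] := ubnP #|S|; elim: n S al => // n IH S al; rewrite ltnS => Sn alS.
have [/forallP small|] := boolP [forall j, #|[set i in S | f i == j]| <= #|K|]%N.
  by exists S, al.
rewrite negb_forall => /existsP[j]; rewrite -ltnNge => big.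
pose row i : 'rV[F]_#|K| := \row_t h i (enum_val t).
have [g [gS [i1 i1S gi1] g0]] := linear_dependence row big.
have gh j' k : \sum_(i | f i == j') g i * h i k = 0.
  have [->|jj'] := eqVneq j' j; last first.
    rewrite big1 // => i /eqP fi; rewrite gS ?mul0r // inE negb_and fi.
    by rewrite (negbTE jj') orbT.
  have := congr1 (fun u : 'rV_#|K| => u 0 (enum_rank k)) g0.
  rewrite summxE [RHS]mxE => c0; rewrite -[RHS]c0.
  rewrite [RHS](bigID (fun i => f i == j)) /= [X in _ = _ + X]big1 => [|i fi].
    by rewrite addr0; apply: eq_bigr => i _; rewrite !mxE enum_rankK.
  have -> : g i = 0 by apply: gS; rewrite inE (negbTE fi) andbF.
  by rewrite scale0r mxE.
pose al1 i := al i - al i1 / g i1 * g i.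
have al1S i : i \notin S :\ i1 -> al1 i = 0.
  rewrite !inE negb_and negbK /al1 => /orP[/eqP ->|iS]; first by rewrite divfK ?subrr.
  have -> : g i = 0 by apply: gS; rewrite inE (negbTE iS).
  by rewrite alS // mulr0 subrr.
have [|S' [al' [sub al'S small sums]]] := IH _ al1 _ al1S.
  by move: i1S; rewrite inE => /andP[i1S _]; rewrite (cardsD1 i1) i1S in Sn.
exists S', al'; split=> // [|j' k]; first exact: subset_trans sub (subD1set _ _).
rewrite sums /al1; under eq_bigr do rewrite mulrBl -[X in _ - X]mulrA.
by rewrite sumrB -mulr_sumr gh mulr0 subr0.
Qed.

(** * Integer polynomials and linear systems at generic points *)

Definition Q_of_int (z : int) : Q :=
  match z with
  | Posz n => inject_Z (Z.of_nat n)
  | Negz n => inject_Z (- Z.of_nat n.+1)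
  end.

Lemma Q2R_of_int (z : int) : Q2R (Q_of_int z) = z%:~R.
Proof.
have QZ x : Q2R (inject_Z x) = IZR x by rewrite /Q2R /= Rinv_1 Rmult_1_r.
case: z => n; rewrite QZ ?opp_IZR -INR_IZR_INZ INRE //.
Qed.

Lemma alg_indep_mmap (I : finType) (x : I -> R) (P : {mpoly int[#|I|]}) :
  alg_indep x -> P != 0 -> mmap intr (fun t => x (enum_val t)) P != 0.
Proof.
move=> ind P0.
pose toffun (m : 'X_{1..#|I|}) : {ffun I -> nat} := [ffun p => m (enum_rank p)].
pose offfun (m : {ffun I -> nat}) : 'X_{1..#|I|} :=
  [multinom m (enum_val t) | t < #|I|].
have toK : cancel toffun offfun.
  by move=> m; apply/mnmP => t; rewrite mnmE ffunE enum_valK.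
have := ind (map toffun (msupp P)) (fun m => Q_of_int P@_(offfun m)).
rewrite big_map (map_inj_uniq (can_inj toK)) msupp_uniq => /(_ isT) neq.
apply/eqP => mP; apply: neq.
  have [m mP0] : exists m, m \in msupp P.
    case: (msupp P) (msupp_eq0 P) => [|m s] e; last by exists m; rewrite mem_head.
    by rewrite -e eqxx in P0.
  exists (toffun m); first exact: map_f.
  rewrite toK => /Qeq_eqR; rewrite Q2R_of_int RMicromega.Q2R_0 => /eqP.
  by rewrite intr_eq0; apply/negP; rewrite -mcoeff_msupp.
rewrite -[RHS]mP; apply: eq_bigr => m _; rewrite toK Q2R_of_int; congr (_ * _).
transitivity (\prod_(i : I) x i ^+ m (enum_rank i)).
  by apply: eq_bigr => i _; rewrite RpowE ffunE.
rewrite /mmap1 [RHS](reindex enum_rank) /=; last first.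
  by exists enum_val => i _; rewrite ?enum_rankK ?enum_valK.
by apply: eq_bigr => i _; rewrite enum_rankK.
Qed.

(** Expresses full row rank as the nonvanishing of a single polynomial in the entries, a form to
    which algebraic independence applies. *)
Lemma gram_det_neq0 (F : realFieldType) m n (D : 'M[F]_(m, n)) :
  reflect (forall v : 'rV_m, v *m D = 0 -> v = 0) (\det (D *m D^T) != 0).
Proof.
apply: (iffP idP) => [det v vD|inj].
  have := mulmxA v D D^T; rewrite vD mul0mx => vDD.
  have u : D *m D^T \in unitmx by rewrite unitmxE unitfE.
  by rewrite -(mulmxK u v) vDD mul0mx.
apply/negP => /det0P[v /negP v0 /mulmx_gram_eq0 /inj vz].
by apply: v0; rewrite vz.
Qed.

(** Homogeneous coordinates; [None] labels the added coordinate 1. *)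
Definition hom (F : nzRingType) (I K : Type) (a : I -> K -> F) (i : I)
    (k : option K) : F :=
  if k is Some k' then a i k' else 1.

(** The Gram determinant of the system is an integer polynomial in the coordinates. It is nonzero at
    the special points [a0], hence a nonzero polynomial, hence nonzero at the independent points
    [a]. *)
Lemma generic_kernel (I K C : finType) (a0 a : I -> K -> R)
    (z : I -> C -> int) (kap : C -> option K) :
  alg_indep (fun p : I * K => a p.1 p.2) ->
  (forall al : I -> R,
     (forall c, \sum_i al i * ((z i c)%:~R * hom a0 i (kap c)) = 0) ->
     forall i, al i = 0) ->
  forall al : I -> R,
    (forall c, \sum_i al i * ((z i c)%:~R * hom a i (kap c)) = 0) ->
    forall i, al i = 0.
Proof.
move=> ind inj0.
pose N := #|{: I * K}|.
pose P i c : {mpoly int[N]} :=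
  (z i c)%:~R * (if kap c is Some k then 'X_(enum_rank (i, k)) else 1).
pose B : 'M[{mpoly int[N]}]_(#|I|, #|C|) :=
  \matrix_(i, c) P (enum_val i) (enum_val c).
pose ev (x : I -> K -> R) : {rmorphism {mpoly int[N]} -> R} :=
  mmap intr (fun t => x (enum_val t).1 (enum_val t).2).
have evP x i c : ev x (P i c) = (z i c)%:~R * hom x i (kap c).
  rewrite rmorphM rmorph_int /hom; case: (kap c) => [k|]; last by rewrite rmorph1.
  by rewrite /= mmapX mmap1U enum_rankK.
have kerE x (v : 'rV_#|I|) : v *m map_mx (ev x) B = 0 <->
    forall c, \sum_i v 0 (enum_rank i) * ((z i c)%:~R * hom x i (kap c)) = 0.
  have vE c : (v *m map_mx (ev x) B) 0 (enum_rank c) =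
      \sum_i v 0 (enum_rank i) * ((z i c)%:~R * hom x i (kap c)).
    rewrite mxE (reindex enum_rank) /=; last first.
      by exists enum_val => i _; rewrite ?enum_rankK ?enum_valK.
    by apply: eq_bigr => i _; rewrite !mxE !enum_rankK evP.
  split=> [v0 c|v0]; first by rewrite -vE v0 mxE.
  by apply/rowP => c; rewrite -[c]enum_valK vE v0 mxE.
have detE x : ev x (\det (B *m B^T)) =
    \det (map_mx (ev x) B *m (map_mx (ev x) B)^T).
  by rewrite map_trmx -map_mxM det_map_mx.
have det0 : \det (B *m B^T) != 0.
  have : ev a0 (\det (B *m B^T)) != 0.
    rewrite detE; apply/gram_det_neq0 => v /kerE v0.
    by apply/rowP => i; rewrite -[i]enum_valK (inj0 _ v0) mxE.
  by apply: contra_neq => ->; rewrite rmorph0.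
have := alg_indep_mmap ind det0; rewrite -[mmap _ _ _]/(ev a _) detE.
move/gram_det_neq0 => inj al al0 i.
have /inj/rowP/(_ (enum_rank i)) : (\row_t al (enum_val t)) *m map_mx (ev a) B = 0.
  apply/kerE => c; rewrite -[RHS](al0 c); apply: eq_bigr => k _.
  by rewrite mxE enum_rankK.
by rewrite !mxE enum_rankK.
Qed.

(* Specialise the points to an affine frame (the origin, labelled None, and the
   unit vectors), labelled so that a block of S never repeats a label and every
   label, except possibly None, is missing from some block: the common block
   sum then has no coordinate along a missing label. *)
Lemma generic_blocks_independent (I K : finType) r (f : I -> 'I_r.+1)
    (a : I -> K -> R) (S : {set I}) (al : I -> R) :
  alg_indep (fun p : I * K => a p.1 p.2) ->
  (forall j, #|[set i in S | f i == j]| <= #|K|.+1)%N ->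
  (#|S| <= r * #|K|.+1)%N \/
    (#|S| <= r * #|K|.+1 + 1)%N /\ \sum_(i | f i == ord0) al i = 0 ->
  (forall i, i \notin S -> al i = 0) ->
  (forall j k, \sum_(i | f i == j) al i * hom a i k =
               \sum_(i | f i == ord0) al i * hom a i k) ->
  forall i, al i = 0.
Proof.
move=> ind small card_or supp blocks.
have [b [Sb b0]] : exists b : bool, (#|S| <= r * #|K|.+1 + b)%N /\
    (b -> \sum_(i | f i == ord0) al i = 0).
  case: card_or => [le|[le s0]]; first by exists false; rewrite addn0.
  by exists true.
have [g [ginj gcard]] := cyclic_labelling small.
pose lab i : option K := omap enum_val (unlift ord0 (g i)).
pose ordk (k : option K) : 'I_#|K|.+1 :=
  if k is Some x then lift ord0 (enum_rank x) else ord0.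
have ordkK i : ordk (lab i) = g i.
  by rewrite /lab; case: unliftP => [t ->|->] //=; rewrite enum_valK.
have labE i k : (lab i == k) = (g i == ordk k).
  have inj : injective ordk.
    by move=> [x|] [y|] //= /lift_inj /enum_rank_inj ->.
  by rewrite -(inj_eq inj) ordkK.
pose a0 i x : R := (lab i == Some x)%:R.
(* The equations of the system: equal block sums, vanishing outside [S], and, when [b] holds, total
   zero in block [ord0]. *)
pose z i (c : 'I_r.+1 * option K + I + unit) : int := match c with
  | inl (inl (j, k)) => (f i == j)%:R - (f i == ord0)%:R
  | inl (inr i') => (i == i')%:R * (i \notin S)%:R
  | inr tt => b%:R * (f i == ord0)%:R end.
pose kap (c : 'I_r.+1 * option K + I + unit) : option K :=
  if c is inl (inl (j, k)) then k else None.
have blockE x (be : I -> R) j k :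
    \sum_i be i * (((f i == j)%:R - (f i == ord0)%:R)%:~R * hom x i k) =
    \sum_(i | f i == j) be i * hom x i k -
    \sum_(i | f i == ord0) be i * hom x i k.
  rewrite [X in _ = X - _]big_mkcond [X in _ = _ - X]big_mkcond -sumrB.
  apply: eq_bigr => i _; by case: (f i == _); case: (f i == _); rewrite /=; ring.
have suppE (be : I -> R) i' :
    \sum_i be i * (((i == i')%:R * (i \notin S)%:R)%:~R * 1) =
    (i' \notin S)%:R * be i'.
  rewrite (bigD1 i') //= eqxx big1 ?addr0 => [|i /negbTE ->]; last by rewrite !mul0r mulr0.
  by case: (i' \in S); rewrite /=; ring.
have sumE (be : I -> R) :
    \sum_i be i * ((b%:R * (f i == ord0)%:R)%:~R * 1) =
    b%:R * \sum_(i | f i == ord0) be i.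
  rewrite [in RHS]big_mkcond mulr_sumr; apply: eq_bigr => i _.
  by case: (f i == _); case: (b); rewrite /=; ring.
apply: (generic_kernel (a0 := a0) (z := z) (kap := kap) ind); last first.
  case=> [[[j k]|i']|[]] /=.
  - by rewrite blockE blocks subrr.
  - rewrite suppE; case: (boolP (i' \in S)) => [_|/supp ->]; first by rewrite mul0r.
    by rewrite mulr0.
  - by rewrite sumE; case: (b) b0 => [->|] //; rewrite ?mulr0 ?mul0r.
move=> be ker0.
have supp0 i : i \notin S -> be i = 0.
  by move=> iS; have := ker0 (inl (inr i)); rewrite /= suppE iS mul1r.
have sum0 : b -> \sum_(i | f i == ord0) be i = 0.
  by move=> bt; have := ker0 (inr tt); rewrite /= sumE bt mul1r.
have blocks0 j k : \sum_(i | f i == j) be i * hom a0 i k =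
    \sum_(i | f i == ord0) be i * hom a0 i k.
  by have /eqP := ker0 (inl (inl (j, k))); rewrite /= blockE subr_eq0 => /eqP.
pose om j k := \sum_(i | f i == j) be i * (lab i == k)%:R.
have om_None j : om j None = \sum_(i | f i == j) be i - \sum_x om j (Some x).
  rewrite exchange_big -sumrB; apply: eq_bigr => i _; rewrite -mulr_sumr.
  case: (lab i) => [x|]; last by rewrite big1 // mulr0 subr0 mulr1.
  by under eq_bigr do rewrite (inj_eq Some_inj) eq_sym; rewrite sum_delta mulr1 subrr mulr0.
have om_const j k : om j k = om ord0 k.
  case: k => [x|]; first exact: (blocks0 j (Some x)).
  rewrite !om_None; congr (_ - _); last first.
    by apply: eq_bigr => x _; apply: (blocks0 j (Some x)).
  have := blocks0 j None; rewrite /hom.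
  by under eq_bigr do rewrite mulr1; under [RHS]eq_bigr do rewrite mulr1.
(* At most [r] indices of [S] carry label [k], so one of the [r.+1] blocks misses it; [om j k]
   vanishes there and does not depend on [j]. *)
have om_missing k : (#|S| <= r * #|K|.+1 + ordk k)%N -> forall j, om j k = 0.
  move=> /gcard le j; pose L := [set i in S | g i == ordk k].
  have [j0 j0L] : exists j0, j0 \notin f @: L.
    apply/existsP; rewrite -negb_forall; apply/negP => /forallP all.
    have := leq_trans (leq_imset_card f L) le; rewrite leqNgt => /negP; apply.
    rewrite -[X in (X <= _)%N]card_ord; apply: subset_leq_card.
    by apply/subsetP => j' _; apply: all.
  rewrite om_const -(om_const j0) /om big1 // => i /eqP fi.
  have [lk|] := eqVneq (lab i) k; last by rewrite mulr0.
  rewrite supp0 ?mul0r //; apply: contra j0L => iS.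
  by apply/imsetP; exists i; rewrite // inE iS -labE lk eqxx.
have om_Some x j : om j (Some x) = 0.
  apply: om_missing; apply: leq_trans Sb _; rewrite leq_add2l.
  by case: (b).
(* For [None], either [b] is false and this label is also missing from a block, or the total and all
   other labels contribute zero. *)
have om0 j k : om j k = 0.
  case: k => [x|] //; case bE : b Sb => Sb'; last exact: om_missing.
  by rewrite om_const om_None sum0 // big1 ?subrr.
move=> i; have [iS|/supp0 //] := boolP (i \in S).
rewrite -[RHS](om0 (f i) (lab i)) /om (bigD1 i) //= eqxx mulr1 big1 ?addr0 //.
move=> i' /andP[/eqP ff i'i]; have [ll|] := eqVneq (lab i') (lab i); last by rewrite mulr0.
rewrite supp0 ?mul0r //; apply: contra i'i => i'S.
by apply/eqP/ginj => //; rewrite -!ordkK ll.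
Qed.

(** A zero coefficient makes the reduced support a proper subset, and [w None = 0] makes the block
    totals vanish. Either way the reduced coefficients are all zero, and then so is [w]. *)
Lemma generic_solution_neq0 (I K : finType) r (f : I -> 'I_r.+1)
    (a : I -> K -> R) (al : I -> R) (w : option K -> R) :
  alg_indep (fun p : I * K => a p.1 p.2) -> #|I| = (r * #|K|.+1 + 1)%N ->
  (forall j k, \sum_(i | f i == j) al i * hom a i k = w k) ->
  (exists k, w k != 0) ->
  (forall i, al i != 0) /\ w None != 0.
Proof.
move=> ind cardI sums [k wk].
have al0 i : i \notin [set i | al i != 0] -> al i = 0.
  by rewrite inE negbK => /eqP.
have [S [be [sub beS small sumsS]]] := reduce_support f (hom a) al0.
have {}small j : (#|[set i in S | f i == j]| <= #|K|.+1)%N.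
  by rewrite -card_option.
have key : ~ ((#|S| <= r * #|K|.+1)%N \/
    (#|S| <= r * #|K|.+1 + 1)%N /\ \sum_(i | f i == ord0) be i = 0).
  move=> h; move/eqP: wk; apply; rewrite -(sums ord0) -sumsS.
  rewrite big1 // => i _; suff -> : be i = 0 by rewrite mul0r.
  by apply: (generic_blocks_independent ind small h beS) => j k'; rewrite !sumsS !sums.
split=> [i|].
  apply/negP => /eqP ali; apply: key; left.
  rewrite -ltnS -[X in (_ < X)%N]addn1 -cardI.
  apply: leq_ltn_trans (subset_leq_card sub) _; rewrite -cardsT; apply: proper_card.
  by apply/properP; split; [apply: subsetT|exists i; rewrite // inE ali eqxx].
apply/negP => /eqP w0; apply: key; right; split; first by rewrite -cardI max_card.
by rewrite -[RHS]w0 -(sums ord0 None) -sumsS /hom; apply: eq_bigr => i _; rewrite mulr1.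
Qed.

(** * The separation hypothesis and the final signs *)

Lemma separated_no_positive_relation n d (a : 'I_n -> 'I_d -> R)
    (M : {set 'I_n}) (b : 'I_n -> R) :
  ~ (exists z, in_conv a M z /\ in_conv a (~: M) z) ->
  convex_weights b ->
  exists k, \sum_i b i * ((-1) ^+ (i \in M) * hom a i k) != 0.
Proof.
move=> hM [b0 b1]; apply/existsP; apply: contraT; rewrite negb_exists => /forallP rel.
have balance k : \sum_(i in M) b i * hom a i k = \sum_(i in ~: M) b i * hom a i k.
  have := rel k; rewrite negbK (bigID (mem M)) /= addrC.
  under eq_bigr => i /negbTE -> do rewrite mul1r.
  under [X in _ + X]eq_bigr => i -> do rewrite expr1 mulN1r mulrN.
  rewrite sumrN subr_eq0 => /eqP <-.
  by apply: eq_bigl => i; rewrite inE.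
(* Coordinate [None] splits the total weight 1 evenly between [M] and its complement, so doubled
   weights are convex on each side. *)
have half : \sum_(i in M) 2 * b i = 1 /\ \sum_(i in ~: M) 2 * b i = 1.
  have e : \sum_(i in M) b i = \sum_(i in ~: M) b i.
    have := balance None; rewrite /hom.
    by under eq_bigr do rewrite mulr1; under [RHS]eq_bigr do rewrite mulr1.
  have t : \sum_(i in M) b i + \sum_(i in ~: M) b i = 1.
    rewrite -b1 [RHS](bigID (mem M)) /=; congr (_ + _).
    by apply: eq_bigl => i; rewrite inE.
  by rewrite -!mulr_sumr; split; lra.
have conv (S : {set 'I_n}) z : \sum_(i in S) 2 * b i = 1 ->
    (forall k, z k = 2 * \sum_(i in S) b i * a i k) -> in_conv a S z.
  move=> S1 zE; exists (fun i => if i \in S then 2 * b i else 0).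
  split=> [i|]; first by apply/RleP; case: ifP => // _; rewrite mulr_ge0.
  split=> [i /negbTE -> //|]; split=> [|k].
    by rewrite -[RHS]S1 [RHS]big_mkcond.
  rewrite zE mulr_sumr big_mkcond; apply: eq_bigr => i _.
  by case: ifP => _; rewrite RmultE ?mulrA ?mul0r.
case: hM; exists (fun k => 2 * \sum_(i in M) b i * a i k).
split; apply: conv => //; try by case: half.
by move=> k; rewrite (balance (Some k)).
Qed.

Local Open Scope R_scope.

Theorem mainTheorem4 (r d n : nat) (hr : (2 <= r)%N) (hd : (1 <= d)%N)
  (hn : n = ((r - 1) * (d + 1) + 1)%N)
  (a : 'I_n -> 'I_d -> R)
  (hind : alg_indep (fun p : 'I_n * 'I_d => a p.1 p.2))
  (M : {set 'I_n})
  (hM : ~ (exists z : 'I_d -> R, in_conv a M z /\ in_conv a (~: M) z)) :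
  exists (f : 'I_n -> 'I_r) (z : 'I_d -> R) (alpha : 'I_n -> R),
    (forall j : 'I_r,
        (forall k : 'I_d,
            z k = \big[Rplus/R0]_(i : 'I_n | f i == j) (alpha i * a i k)) /\
        1 = \big[Rplus/R0]_(i : 'I_n | f i == j) alpha i) /\
    ((forall i : 'I_n, alpha i < 0 <-> i \in M) \/
     (forall i : 'I_n, alpha i < 0 <-> i \notin M)).
Proof.
(* From here [r] is the number of blocks minus one, so there are [r * d.+1 + 1] points. *)
case: r hr hn => [//|r] _ hn.
have cardI : #|'I_n| = (r * #|'I_d|.+1 + 1)%N by rewrite !card_ord hn subn1 !addn1.
pose v i k := ((-1) ^+ (i \in M) * hom a i k)%R.
have [|f [b [w [cb sums]]]] := conic_tverberg (r := r) v.
  by rewrite card_option cardI addn1.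
pose al i := (b i * (-1) ^+ (i \in M))%R.
have sums' j k : (\sum_(i | f i == j) al i * hom a i k = w k)%R.
  by rewrite -(sums j); apply: eq_bigr => i _; rewrite mulrA.
have w0 : exists k, w k != 0%R.
  have [k wk] := separated_no_positive_relation hM cb; exists k.
  apply: contra_neq wk => wk0; rewrite (partition_big f predT) //= big1 // => j _.
  by rewrite -[RHS]wk0 -(sums j).
have [al0 t0] := generic_solution_neq0 hind cardI sums' w0.
have b_gt0 i : (0 < b i)%R.
  rewrite lt_def cb.1 andbT; apply: contra_neq (al0 i) => bi.
  by rewrite /al bi mul0r.
set t := w None in t0.
exists f, (fun k => (w (Some k) / t)%R), (fun i => (al i / t)%R); split=> [j|].
  split=> [k|].
    rewrite -(sums' j) mulr_suml; apply: eq_bigr => i _.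
    by rewrite RmultE mulrAC.
  rewrite -[LHS](divff t0) {1}/t -(sums' j None) mulr_suml.
  by apply: eq_bigr => i _; rewrite /hom mulr1.
(* As [b i] is positive, [al i] is negative exactly on [M]; dividing by a negative [t] swaps the two
   sides. *)
have sgn i : (al i / t < 0)%R = ((i \in M) == (0 < t)%R).
  have [tp|tn|t_0] := ltgtP 0%R t; last by rewrite -t_0 eqxx in t0.
    rewrite pmulr_llt0 ?invr_gt0 // /al pmulr_rlt0 //.
    by case: (i \in M); rewrite ?expr1 ?expr0 ?oppr_lt0 ?ltr01 ?ltr10.
  rewrite nmulr_llt0 ?invr_lt0 // /al pmulr_rgt0 //.
  by case: (i \in M); rewrite ?expr1 ?expr0 ?oppr_gt0 ?ltr01 ?ltr10.
case tp : (0 < t)%R; [left|right] => i; split.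
- by move/RltP; rewrite sgn tp eqb_id.
- by move=> iM; apply/RltP; rewrite sgn tp iM.
- by move/RltP; rewrite sgn tp eqbF_neg.
- by move=> iM; apply/RltP; rewrite sgn tp eqbF_neg.
Qed.
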